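(* Let $G$ be a finite group. Then $\mathrm{SNorm}(G)=\mathrm{Nilp}(G)$ if and only if for every odd prime $p$ the Sylow $p$-subgroups of $G$ are abelian, and the Sylow $2$-subgroups of $G$ are either abelian or a direct product of the quaternion group $Q_8$ of order $8$ and an elementary abelian $2$-group.
   Context: Both graphs are simple undirected graphs with vertex set $G$. For distinct $x,y\in G$: $x,y$ are adjacent in the symmetric normaliser graph $\mathrm{SNorm}(G)$ iff $x\in N(\langle y\rangle)$ and $y\in N(\langle x\rangle)$, where $N(H)$ is the normaliser of the subgroup $H$ in $G$; $x,y$ are adjacent in the nilpotent graph $\mathrm{Nilp}(G)$ iff $\langle x,y\rangle$ is nilpotent. The graphs are equal when they have the same edge set. The trivial group counts as an elementary abelian $2$-group. *)

(* Defs.v *)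
From mathcomp Require Import all_boot all_fingroup all_solvable.

Set Implicit Arguments.
Unset Strict Implicit.
Unset Printing Implicit Defensive.

Local Open Scope group_scope.

Section Graphs.

Variable gT : finGroupType.
Implicit Type G : {group gT}.

Definition snorm_adj G : rel gT :=
  fun x y => (x \in 'N_G(<[y]>)) && (y \in 'N_G(<[x]>)).

Definition nilp_adj : rel gT := fun x y => nilpotent <<[set x; y]>>.

(* Both graphs have vertex set G, so each is represented by its set of edges,  *)
(* an edge being the unordered pair of its two distinct endpoints.            *)
Definition edge_set (G : {set gT}) (e : rel gT) : {set {set gT}} :=
  [set [set x; y] | x in G, y in G & (x != y) && e x y].

Definition SNorm G : {set {set gT}} := edge_set G (snorm_adj G).

Definition Nilp G : {set {set gT}} := edge_set G nilp_adj.

End Graphs.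

(* Main.v *)
Require Import Defs.
From mathcomp Require Import all_boot all_fingroup all_solvable.

Set Implicit Arguments.
Unset Strict Implicit.

Local Open Scope group_scope.

(** The theorem reduces to the classification of the finite p-groups in which
    every cyclic subgroup is normal (Dedekind p-groups).

    If x and y normalise each other's cyclic subgroups, then <[x]> and <[y]>
    are abelian normal subgroups of the subgroup they generate, so both lie in
    its Fitting subgroup and that subgroup is nilpotent. Hence SNorm is always
    contained in Nilp. If the graphs are equal, any two elements of a Sylow
    subgroup P generate a p-group, hence are joined in Nilp and therefore in
    SNorm: P is Dedekind. Conversely a nilpotent <<[set x; y]>> is the product
    of its primary components, so y moves each primary part of x only through
    the primary part of y for the same prime, and there one works inside a
    Sylow subgroup. So equality holds iff all Sylow subgroups are Dedekind
    ([eq_graphs_dedekind]).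

    In a non-abelian Dedekind p-group P, take a non-commuting pair x, y for
    which #[x] * #[y] is minimal. The commutator [~ x, y] lies in both cycles,
    so it is central in <[x]> <*> <[y]>, and minimality gives it order p.
    If y is the one of smaller or equal order, multiplying it by a suitable
    power of x would lower its order and so contradict minimality, unless
    p = 2 and both orders are 4 ([minimal_noncommuting_order]); then x and y
    generate a copy Q of Q_8.
    Every element of P acts on Q as an inner automorphism of Q does, so
    P = Q * 'C_P(Q) ([dedekind_Q8_cprod]); 'C_P(Q) has no element of order 4
    ([dedekind_cent_no_order4]), hence is elementary abelian, and a complement
    E of Q :&: 'C_P(Q) in 'C_P(Q) gives P = Q \x E. In such a product, in turn,
    every conjugate of an element is that element or its inverse, so that the
    product is Dedekind ([dedekind_dprod_Q8]). *)

(** * The two graphs and Dedekind Sylow subgroups *)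

(** Normality is demanded of cyclic subgroups only; since every subgroup is
    generated by its cyclic subgroups, for a group [A] this is the usual
    condition that all subgroups be normal. *)
Definition dedekind {gT : finGroupType} (A : {set gT}) :=
  {in A &, forall x y, x ^ y \in <[x]>}.

Section GraphLemmas.

Variable gT : finGroupType.
Implicit Types (G H P : {group gT}) (x y z : gT).

Lemma joing_cyclesE x y : <<[set x; y]>> = <[x]> <*> <[y]>.
Proof. by rewrite joing_idl joing_idr. Qed.

(** Both cycles are abelian and normal in the group they generate, so that
    group coincides with its Fitting subgroup. *)
Lemma nilpotent_norm_cycles x y :
  x \in 'N(<[y]>) -> y \in 'N(<[x]>) -> nilpotent <<[set x; y]>>.
Proof.
move=> nyx nxy; rewrite joing_cyclesE; set H := _ <*> _.
suff sHF: H \subset 'F(H) by apply: nilpotentS (Fitting_nil H).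
have nX: <[x]> <| H.
  by rewrite /normal joing_subl join_subG normG cycle_subG.
have nY: <[y]> <| H.
  by rewrite /normal joing_subr join_subG normG cycle_subG nyx.
by rewrite join_subG !Fitting_max // abelian_nil ?cycle_abelian.
Qed.

Lemma commute_conj x y : commute x y -> x ^ y = x.
Proof. by move=> cxy; rewrite conjgE [x * y]cxy mulKg. Qed.

Lemma abelian_dedekind (A : {set gT}) : abelian A -> dedekind A.
Proof.
move=> cAA x y Ax Ay; rewrite commute_conj ?cycle_id //; exact: (centsP cAA).
Qed.

(** In the nilpotent group generated by [x] and [y] the p'-part of [y]
    centralises the p-part of [x], so only the p-part of [y] acts on it; both
    p-parts lie in a single Sylow p-subgroup of [G]. *)
Lemma nilpotent_conj_cycle G x y :
    (forall p P, prime p -> p.-Sylow(G) P -> dedekind P) ->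
    x \in G -> y \in G -> nilpotent <<[set x; y]>> -> x ^ y \in <[x]>.
Proof.
move=> dedS Gx Gy; pose H := <<[set x; y]>>%G => nilH.
have Hx: x \in H by rewrite mem_gen // !inE eqxx.
have Hy: y \in H by rewrite mem_gen // !inE eqxx orbT.
have sHG: H \subset G by rewrite gen_subG; apply/subsetP=> z /set2P[] ->.
suff conjp (p : nat) : x.`_p ^ y \in <[x.`_p]>.
  rewrite -[x in x ^ _]prod_constt.
  rewrite (big_morph (conjg^~ y) (fun a b => conjMg a b y) (conj1g y)).
  apply: group_prod => p _; apply: subsetP (conjp p).
  by rewrite cycle_subG cycle_constt.
(* The product of constituents ranges over all naturals, primes or not. *)
have [p_pr | p'p] := boolP (prime p); last first.
  have -> : x.`_p = 1; last by rewrite conj1g group1.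
  apply/constt1P/pnatP=> // q q_pr _; rewrite !inE.
  by apply: contraNneq p'p => <-.
have hallO := nilpotent_pcore_Hall p nilH.
have memO z : z \in H -> z.`_p \in 'O_p(H).
  move=> Hz; rewrite (mem_normal_Hall hallO) ?pcore_normal ?p_elt_constt //.
  exact: groupX.
have sOG := subset_trans (pcore_sub p H) sHG.
have [P sylP sOP] := Sylow_superset sOG (pcore_pgroup p H).
have Pxp := subsetP sOP _ (memO x Hx).
have Pyp := subsetP sOP _ (memO y Hy).
have xpy := dedS p P p_pr sylP _ _ Pxp Pyp.
rewrite -[y in _ ^ y](consttC p) conjgM.
suff cxy: y.`_p^' \in 'C(<[x.`_p]>).
  by rewrite commute_conj //; apply/commute_sym/(centP cxy).
rewrite -cycle_subG (sub_nilpotent_cent2 nilH) ?cycle_subG ?groupX //.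
apply: (@pnat_coprime p); exact: p_elt_constt.
Qed.

(** An unordered pair determines its endpoints only up to order, so reading
    adjacency off an edge needs the relation to be symmetric. *)
Lemma mem_edge_set (A : {set gT}) (e : rel gT) x y :
  symmetric e -> x \in A -> y \in A ->
  ([set x; y] \in edge_set A e) = (x != y) && e x y.
Proof.
move=> sym_e Ax Ay; apply/imset2P/andP=> [[u v] | [xy exy]]; last first.
  by exists x y; rewrite ?inE ?Ay ?xy.
rewrite !inE => Au /and3P[Av uv euv] Exy.
have: x \in [set u; v] by rewrite -Exy set21.
have: y \in [set u; v] by rewrite -Exy set22.
have: u \in [set x; y] by rewrite Exy set21.
have: v \in [set x; y] by rewrite Exy set22.
rewrite !inE; do 4![case/orP=> /eqP ?]; subst; rewrite ?eqxx in uv *; split=> //.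
all: by rewrite 1?eq_sym 1?sym_e.
Qed.

Lemma eq_edge_set (A : {set gT}) (e1 e2 : rel gT) :
  {in A &, e1 =2 e2} -> edge_set A e1 = edge_set A e2.
Proof.
have sub f1 f2 : {in A &, f1 =2 f2} -> edge_set A f1 \subset edge_set A f2.
  move=> eq_f; apply/subsetP=> _ /imset2P[x y Ax + ->].
  rewrite inE => /and3P[Ay nxy f1xy]; apply: imset2_f => //.
  by rewrite inE Ay nxy -eq_f.
by move=> eq_e; apply/eqP; rewrite eqEsubset !sub // => x y *; rewrite eq_e.
Qed.

Lemma nilp_adj_sym : symmetric (@nilp_adj gT).
Proof. by move=> x y; rewrite /nilp_adj setUC. Qed.

Lemma snorm_adj_sym G : symmetric (snorm_adj G).
Proof. by move=> x y; rewrite /snorm_adj andbC. Qed.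

Lemma mem_norm_cycle x y :
  (y \in 'N(<[x]>)) = (x ^ y \in <[x]>).
Proof. by rewrite -cycle_subG norms_cycle. Qed.

Lemma eq_graphs_dedekind G :
  SNorm G = Nilp G <->
  (forall (p : nat) P, prime p -> p.-Sylow(G) P -> dedekind P).
Proof.
split=> [eqSN p P p_pr sylP x y Px Py | dedS].
  have [Gx Gy] := (subsetP (pHall_sub sylP) x Px, subsetP (pHall_sub sylP) y Py).
  have [<- | nxy] := eqVneq x y; first by rewrite commute_conj ?cycle_id.
  have: [set x; y] \in Nilp G.
    rewrite mem_edge_set //; last exact: nilp_adj_sym.
    rewrite nxy; apply: nilpotentS (pgroup_nil (pHall_pgroup sylP)).
    by rewrite gen_subG; apply/subsetP=> z /set2P[] ->.
  rewrite -eqSN mem_edge_set //; last exact: snorm_adj_sym.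
  by case/and3P=> _ _ /setIP[_]; rewrite mem_norm_cycle.
apply: eq_edge_set => x y Gx Gy; apply/andP/idP => [[] | nil_xy].
  by move=> /setIP[_ nyx] /setIP[_ nxy]; apply: nilpotent_norm_cycles.
rewrite !in_setI Gx Gy !mem_norm_cycle !(nilpotent_conj_cycle dedS) //.
by rewrite setUC.
Qed.

End GraphLemmas.

(** * Elements of order 4 and the quaternion group *)

Section Dedekind.

Variable gT : finGroupType.
Implicit Types (G H P Q E S : {group gT}) (x y z : gT).

Lemma order4_generator x z : #[x] = 4 -> z \in <[x]> -> #[z] = 4 ->
  z = x \/ z = x^-1.
Proof.
move=> ox /cyclePmin[i]; rewrite ox.
case: i => [|[|[|[|//]]]] _ -> //; rewrite ?order1 ?expg1 //; auto.
  by move/eqP; rewrite orderXdiv ox.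
move=> _; right; apply/eqP; rewrite eq_sym eq_invg_mul -expgS.
by rewrite -order_dvdn ox.
Qed.

Lemma order4_square x z : #[x] = 4 -> z \in <[x]> -> #[z] = 2 -> z = x ^+ 2.
Proof.
move=> ox /cyclePmin[i]; rewrite ox.
by case: i => [|[|[|[|//]]]] _ ->; rewrite ?orderXgcd ?ox //.
Qed.

(** Let X be the standard cyclic subgroup of order 4. On X conjugation is
    trivial or inverts; an element outside X has order 4, so it generates a
    subgroup of index 2, which is normal, and its conjugates are generators of
    that subgroup. *)
Lemma Q8_conj Q : Q \isog 'Q_8 -> {in Q &, forall q r, q ^ r = q \/ q ^ r = q^-1}.
Proof.
move=> isoQ; have [[x y] genQ _] := @generators_quaternion _ Q 3 isT isoQ.
have [[_ ord4 invX] _ _ _ _] := @quaternion_structure _ Q 3 x y isT genQ isoQ.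
have [oQ _ _ _] := genQ => q r Qq Qr.
have [Xq | X'q] := boolP (q \in <[x]>).
  have [Xr | X'r] := boolP (r \in <[x]>); last first.
    by right; apply: invX; rewrite ?inE ?X'r.
  left; apply: commute_conj; exact: (centsP (cycle_abelian x)).
have oq: #[q] = 4 by apply: ord4; rewrite inE X'q.
apply: order4_generator; rewrite ?orderJ //.
have: <[q]> <| Q.
  apply: index2_normal; rewrite ?cycle_subG // -divgS ?cycle_subG //.
  by rewrite oQ -orderE oq.
by case/andP=> _ /subsetP/(_ r Qr) nq; rewrite memJ_norm ?cycle_id.
Qed.

(** Elements of [E] are their own inverses, so an inversion of the [Q]-part is
    an inversion of the whole element. *)
Lemma dedekind_dprod_Q8 Q E S :
  Q \x E = S -> Q \isog 'Q_8 -> 2.-abelem E -> dedekind S.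
Proof.
case/dprodP=> _ defS cQE _ isoQ /abelemP[] // cEE expE.
rewrite /dedekind -defS => _ _ /mulsgP[q e Qq Ee ->] /mulsgP[r f Qr Ef ->].
have cqe: q * e = e * q by apply/esym/(centsP cQE).
have -> : (q * e) ^ (r * f) = q ^ r * e.
  have Qqr: q ^ r \in Q by rewrite groupJ.
  rewrite conjMg !conjgM [e ^ r]commute_conj; last exact: (centsP cQE).
  rewrite [e ^ f]commute_conj; last exact: (centsP cEE).
  by rewrite [_ ^ f]commute_conj //; apply/commute_sym/(centsP cQE).
have [-> | ->] := Q8_conj isoQ Qq Qr; first exact: cycle_id.
have {1}-> : e = e^-1 by apply/eqP; rewrite eq_sym eq_invg_mul -expg2 expE.
by rewrite -invMg groupV -cqe cycle_id.
Qed.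

Lemma order4_invert x y :
  #[x] = 4 -> [~ x, y] \in <[x]> -> #[[~ x, y]] = 2 -> x ^ y = x^-1.
Proof.
move=> ox xc oc; apply/eqP; rewrite conjg_mulR (order4_square ox xc oc).
by rewrite -expgS eq_sym eq_invg_mul -expgS -order_dvdn ox.
Qed.

(** The relations exhibit the group as a quotient of 'Q_8; having order a
    multiple of 4 and greater than 4, it is not a proper one. *)
Lemma isog_Q8 x y :
    #[x] = 4 -> #[y] = 4 -> y ^+ 2 = x ^+ 2 -> x ^ y = x^-1 -> y \notin <[x]> ->
  <[x]> <*> <[y]> \isog 'Q_8.
Proof.
move=> ox oy y2 xy X'y.
have ge8: 8 <= #|<[x]> <*> <[y]>|.
  have: 4 %| #|<[x]> <*> <[y]>| by rewrite -ox cardSg ?joing_subl.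
  have: #|<[x]> <*> <[y]>| > 4.
    rewrite -ox proper_card // properE joing_subl join_subG subxx /=.
    by rewrite cycle_subG.
  by move=> gt4 /dvdnP[k Ek]; rewrite Ek in gt4 *; case: k gt4 {Ek} => [|[|k]].
rewrite isogEcard (@card_quaternion 3) // ge8 andbT.
rewrite (@Grp_quaternion 3) //; apply/existsP; exists (x, y) => /=.
by rewrite !xpair_eqE y2 xy -order_dvdn ox !eqxx.
Qed.

(** * A minimal non-commuting pair *)

(** This governs the correction term in the p ^ n-th power of a product in
    class 2: the term vanishes except for p = 2 and n = 1, which is where Q_8
    comes from. *)
Lemma prime_dvd_bin2_expn p n :
  prime p -> 0 < n -> p %| 'C(p ^ n, 2) = odd p || (1 < n).
Proof.
case: n => // n p_pr _.
have [odd_p | even_p] := boolP (odd p).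
  (* 2 * 'C(m, 2) = m * (m - 1), and 2 is invertible modulo p. *)
  rewrite -(@Gauss_dvdr p 2) ?coprimen2 //.
  by rewrite -[2]/(2`!) mulnC bin_ffact ffactnS expnS -mulnA dvdn_mulr.
have -> : p = 2 by case/even_prime: p_pr even_p => // ->.
have -> : 'C(2 ^ n.+1, 2) = (2 ^ n * (2 ^ n.+1).-1)%N.
  by rewrite bin2 expnS -mulnA mul2n doubleK.
rewrite Gauss_dvdl; last by rewrite coprime2n -subn1 oddB ?expn_gt0 // oddX.
by rewrite Euclid_dvdX // dvdnn.
Qed.

Lemma cycle_of_prime_order x z p m :
  prime p -> #[x] = (p ^ m.+1)%N -> z \in <[x]> -> #[z] = p ->
  <[z]> = <[x ^+ (p ^ m)]>.
Proof.
move=> p_pr ox xz oz; apply/eqP; rewrite (eq_subG_cyclic (cycle_cyclic x)).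
- rewrite -!orderE oz orderXdiv ox expnS ?dvdn_mull // mulnK //.
  by rewrite expn_gt0 prime_gt0.
- by rewrite cycle_subG.
by rewrite cycle_subG mem_cycle.
Qed.

Lemma exists_minimal_noncommuting P :
  ~~ abelian P ->
  exists x y, [/\ x \in P, y \in P, ~ commute x y
    & {in P &, forall u v, #[u] * #[v] < #[x] * #[y] -> commute u v}].
Proof.
pose bad (u : gT * gT) := [&& u.1 \in P, u.2 \in P & u.1 * u.2 != u.2 * u.1].
move=> ncP; have [u0 bad0]: exists u, bad u.
  apply/existsP; apply: contraR ncP => /existsPn nb.
  apply/centsP=> x Px y Py; apply/eqP; apply: contraR (nb (x, y)) => nxy.
  by rewrite /bad /= Px Py nxy.
case: (arg_minnP (fun u => #[u.1] * #[u.2])%N bad0) => -[x y].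
case/and3P=> /= Px Py /eqP nxy min.
exists x, y; split=> // u v Pu Pv lt_uv; apply/eqP.
apply: contraLR lt_uv => nuv; rewrite -leqNgt; apply: (min (u, v)).
by rewrite /bad /= Pu Pv nuv.
Qed.

Lemma dedekind_comm P x y : dedekind P -> x \in P -> y \in P ->
  [~ x, y] \in <[x]> /\ [~ x, y] \in <[y]>.
Proof.
move=> dP Px Py; split; first by rewrite groupM ?groupV ?cycle_id ?dP.
by rewrite commgEr groupM ?cycle_id // conjVg groupV dP.
Qed.

(** Say #[y] = p ^ b.+2 <= #[x] = p ^ a.+2. The commutator c has order p and
    lies in both cycles, so <[c]> is generated by the p ^ a.+1-st power of x as
    well as by the p ^ b.+1-st power of y. So some power v of x has a
    p ^ b.+1-st power cancelling that of y, and w = y * v, which still does not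
    commute with x, satisfies w ^+ (p ^ b.+1) = c ^+ e for an explicit
    exponent e divisible by p unless p = 2 and a = b = 0. When p divides e, w
    has smaller order than y, against minimality. *)
Lemma minimal_noncommuting_order p P x y :
    prime p -> p.-group P -> dedekind P -> x \in P -> y \in P ->
    ~ commute x y ->
    {in P &, forall u v, #[u] * #[v] < #[x] * #[y] -> commute u v} ->
  [/\ p = 2, #[x] = 4, #[y] = 4 & #[[~ x, y]] = 2].
Proof.
move=> p_pr pP dP.
wlog le_yx: x y / #[y] <= #[x].
  move=> IH; case/orP: (leq_total #[y] #[x]) => [|le_xy Px Py nxy min].
    exact: IH.
  have [||p2 oy ox oc] := IH y x le_xy Py Px.
  - by move/commute_sym.
  - by move=> u v Pu Pv; rewrite [(#[y] * _)%N]mulnC => /(min _ _ Pu Pv).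
  by split; rewrite // -invg_comm orderV.
move=> Px Py nxy min.
have [] := dedekind_comm dP Px Py; set c := [~ x, y] => xc yc.
have cxc : commute x c by apply: (centsP (cycle_abelian x)); rewrite ?cycle_id.
have cyc : commute y c by apply: (centsP (cycle_abelian y)); rewrite ?cycle_id.
have c_neq1: c != 1 by apply/commgP.
have p_gt1 := prime_gt1 p_pr.
have ppow z : z \in P -> exists k, #[z] = (p ^ k)%N.
  by move=> Pz; have [k ->] := p_natP (mem_p_elt pP Pz); exists k.
(* By minimality x ^+ p, of smaller order than x, commutes with y. *)
have oc : #[c] = p.
  apply: nt_prime_order => //; rewrite -commXg //; apply/eqP/commgP.
  apply: min; rewrite ?groupX // ltn_pmul2r ?order_gt0 //.
  have [[|k] ox] := ppow x Px.
    case: nxy; have/eqP := ox; rewrite order_eq1 => /eqP ->.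
    exact/commute_sym/commute1.
  rewrite orderXdiv ox expnS ?dvdn_mulr // mulKn ?prime_gt0 //.
  by rewrite ltn_Pmull ?expn_gt0 ?prime_gt0.
(* A cycle of order p containing c would be <[c]>, which is centralised. *)
have exp_ge2 z t : z \in P -> c \in <[z]> -> commute t c -> ~ commute z t ->
    exists k, #[z] = (p ^ k.+2)%N.
  move=> Pz zc ctc nzt; have [[|[|k]] oz] := ppow z Pz; last by exists k.
    case: nzt; have/eqP := oz; rewrite order_eq1 => /eqP ->.
    exact/commute_sym/commute1.
  have: z \in <[c]>.
    by rewrite (cycle_of_prime_order p_pr oz zc oc) cycle_id.
  by case/cycleP=> i def_z; case: nzt; rewrite def_z; apply/commute_sym/commuteX.
have [a ox] := exp_ge2 x y Px xc cyc nxy.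
have [b oy] : exists k, #[y] = (p ^ k.+2)%N.
  by apply: (exp_ge2 y x) => // /commute_sym.
have le_ba: b <= a by move: le_yx; rewrite ox oy leq_exp2l.
have [k def_k]: exists k,
    y ^+ (p ^ b.+1) * (x ^+ (p ^ (a - b) * k)) ^+ (p ^ b.+1) = 1.
  have: (y ^+ (p ^ b.+1))^-1 \in <[x ^+ (p ^ a.+1)]>.
    rewrite groupV /= -(cycle_of_prime_order p_pr ox xc oc).
    by rewrite (cycle_of_prime_order p_pr oy yc oc) cycle_id.
  case/cycleP=> k def_yV; exists k; rewrite -expgM mulnAC -expnD addnS subnK //.
  by rewrite expgM -def_yV mulgV.
set v := x ^+ _ in def_k; pose w := y * v.
have cxv: commute x v by apply: commuteX.
have Pw: w \in P by rewrite groupM ?groupX.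
have nxw: ~ commute x w.
  move=> cxw; apply: nxy; rewrite -[y](mulgK v) -/w.
  by apply: commuteM; rewrite //; apply: commuteV.
have vy: [~ v, y] = c ^+ (p ^ (a - b) * k) by rewrite commXg.
have w1: w ^+ (p ^ b.+1) = c ^+ (p ^ (a - b) * k * 'C(p ^ b.+1, 2)).
  have cvc: commute v c by apply/commute_sym/commuteX/commute_sym.
  by rewrite expMg_Rmul vy ?def_k ?mul1g -?expgM //; apply: commuteX.
have ndvd: ~~ (p %| p ^ (a - b) * k * 'C(p ^ b.+1, 2)).
  apply/negP=> dvd_p; case: nxw; apply: min => //.
  rewrite ltn_pmul2l ?order_gt0 //.
  apply: (@leq_ltn_trans (p ^ b.+1)).
    by rewrite dvdn_leq ?expn_gt0 ?prime_gt0 // order_dvdn w1 -order_dvdn oc.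
  by rewrite oy ltn_exp2l.
have [b0 p2]: b = 0 /\ p = 2.
  have: ~~ (p %| 'C(p ^ b.+1, 2)) by apply: contra ndvd; apply: dvdn_mull.
  rewrite prime_dvd_bin2_expn // negb_or => /andP[even_p].
  rewrite ltnS lt0n negbK => /eqP ->; split=> //.
  by case/even_prime: p_pr even_p => // ->.
have a0: a = 0.
  apply/eqP; rewrite -leqn0 leqNgt; apply: contra ndvd => a_gt0.
  by rewrite b0 subn0 -(prednK a_gt0) expnS -!mulnA dvdn_mulr.
by rewrite ox oy oc a0 b0 p2.
Qed.

(** * Splitting off the quaternion subgroup *)

(** An element of [P] fixes or inverts each of [x] and [y]; the four
    combinations are realised by conjugation with 1, x, y and x * y. *)
Lemma dedekind_Q8_cprod P x y :
    dedekind P -> x \in P -> y \in P -> #[x] = 4 -> #[y] = 4 ->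
    x ^ y = x^-1 -> y ^ x = y^-1 ->
  P \subset 'C(<[x]> <*> <[y]>) * (<[x]> <*> <[y]>).
Proof.
move=> dP Px Py ox oy xy yx; set Q := _ <*> _.
have Qx: x \in Q by rewrite mem_gen // inE cycle_id.
have Qy: y \in Q by rewrite mem_gen // inE cycle_id orbT.
apply/subsetP=> g Pg.
suff [h Qh [xh yh]] : exists2 h, h \in Q & x ^ h = x ^ g /\ y ^ h = y ^ g.
  rewrite -(mulgKV h g) mem_mulg //.
  rewrite centY inE !cent_cycle; apply/andP.
  split; apply/cent1P/commute_sym/commgP/conjg_fixP.
    by rewrite conjgM -xh conjgK.
  by rewrite conjgM -yh conjgK.
have xx: x ^ x = x by apply: commute_conj.
have yy: y ^ y = y by apply: commute_conj.
have [||-> | ->] := @order4_generator x (x ^ g) ox; rewrite ?orderJ ?dP //;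
  have [||-> | ->] := @order4_generator y (y ^ g) oy; rewrite ?orderJ ?dP //.
- by exists 1; rewrite ?conjg1.
- by exists x.
- by exists y.
by exists (x * y); rewrite ?groupM // !conjgM xx xy yx conjVg yy.
Qed.

(** Put u = x * w with w of order 4. Then [~ u, y] = x ^+ 2 lies in <[u]>. The
    group <[u]> cannot have order at most 2, or it would be <[x ^+ 2]> and u
    would commute with y; so u has order 4, and x ^+ 2, its element of order 2,
    equals u ^+ 2 = x ^+ 2 * w ^+ 2. This forces w ^+ 2 = 1. *)
Lemma dedekind_cent_no_order4 P x y w :
    dedekind P -> x \in P -> y \in P -> w \in P ->
    #[x] = 4 -> [~ x, y] = x ^+ 2 -> commute x w -> commute y w -> #[w] != 4.
Proof.
move=> dP Px Py Pw ox cxy cxw cyw; apply/eqP=> ow.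
have x2n1: x ^+ 2 != 1 by rewrite -order_dvdn ox.
pose u := x * w; have uy: [~ u, y] = x ^+ 2.
  have wy1: [~ w, y] = 1 by apply/eqP/commgP/commute_sym.
  rewrite commMgJ wy1 mulg1 cxy commute_conj //; apply/commute_sym/commuteX.
  exact: commute_sym.
have [] := dedekind_comm dP (groupM Px Pw) Py; rewrite -/u uy => uc yc.
have u2: u ^+ 2 = x ^+ 2 * w ^+ 2 by apply: expgMn.
have u4: #[u] %| 2 ^ 2.
  rewrite order_dvdn expgMn //.
  have [x4 w4] := (expg_order x, expg_order w).
  rewrite ox in x4; rewrite ow in w4.
  by rewrite x4 w4 mulg1.
have nu2: ~~ (#[u] %| 2).
  rewrite order_dvdn; apply/eqP=> u21; move: x2n1; rewrite -uy; case/negP.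
  have: <[x ^+ 2]> = <[u]>.
    apply/eqP; rewrite eqEcard cycle_subG uc -!orderE orderXdiv ox //=.
    by rewrite dvdn_leq // order_dvdn u21.
  move=> defu; have: u \in <[x ^+ 2]> by rewrite defu cycle_id.
  case/cycleP=> i def_u; apply/commgP/commute_sym; rewrite def_u.
  by case/cycleP: yc => j ->; do 2!apply: commuteX.
have ou: #[u] = 4.
  have /(dvdn_pfactor _ 2 (isT : prime 2))[m le_m2 om] := u4.
  by move: nu2; rewrite om; case: m le_m2 {om} => [|[|[|]]].
have := order4_square ou uc.
rewrite orderXdiv ox // => /(_ erefl)/eqP.
by rewrite u2 -{1}[x ^+ 2]mulg1 (inj_eq (mulgI _)) eq_sym -order_dvdn ow.
Qed.

(** The factor [E] is a complement in the centraliser of the quaternion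
    subgroup [Q], not in [P]: it exists because that centraliser is elementary
    abelian. *)
Lemma dedekind_pgroup_structure p P :
    prime p -> p.-group P -> dedekind P -> ~~ abelian P ->
  p = 2 /\ exists Q E : {group gT}, [/\ Q \x E = P, Q \isog 'Q_8 & 2.-abelem E].
Proof.
move=> p_pr pP dP /exists_minimal_noncommuting[x [y [Px Py nxy min]]].
have [p2 ox oy oc] := minimal_noncommuting_order p_pr pP dP Px Py nxy min.
split=> //; rewrite {p min p_pr}p2 in pP.
have [xc yc] := dedekind_comm dP Px Py.
have cx2 := order4_square ox xc oc; have cy2 := order4_square oy yc oc.
have xy := order4_invert ox xc oc.
have yx: y ^ x = y^-1.
  by apply: order4_invert; rewrite // -invg_comm ?groupV ?orderV.
have X'y: y \notin <[x]>.
  by apply/negP=> /cycleP[i def_y]; apply: nxy; rewrite def_y; apply: commuteX.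
pose Q := (<[x]> <*> <[y]>)%G.
have isoQ: Q \isog 'Q_8 by apply: isog_Q8; rewrite // -cx2 -cy2.
have sQP: Q \subset P by rewrite join_subG !cycle_subG Px.
have Qx: x \in Q by rewrite mem_gen // inE cycle_id.
have Qy: y \in Q by rewrite mem_gen // inE cycle_id orbT.
have abelC: 2.-abelem 'C_P(Q).
  apply: exponent2_abelem; apply/exponentP=> z /setIP[Pz /centP cQz].
  (* If z had order 2 ^ k.+2, its 2 ^ k-th power would have order 4. *)
  have [k oz] := p_natP (mem_p_elt pP Pz).
  apply/eqP; rewrite -order_dvdn oz; case: k oz => [|[|k]] // oz.
  have cxz := commuteX (2 ^ k) (commute_sym (cQz x Qx)).
  have cyz := commuteX (2 ^ k) (commute_sym (cQz y Qy)).
  have Pz2k := groupX (2 ^ k) Pz.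
  have/negP[] := dedekind_cent_no_order4 dP Px Py Pz2k ox cx2 cxz cyz.
  have pow2: (2 ^ k.+2)%N = (4 * 2 ^ k)%N by rewrite !expnS mulnA.
  by rewrite orderXdiv oz pow2 ?dvdn_mull // mulnK ?expn_gt0.
have /splitsP[E /complP[tiE defC]] := abelem_splits abelC (subsetIr Q 'C_P(Q)).
have sEC: E \subset 'C_P(Q) by rewrite -defC mulG_subr.
exists Q, E; split=> //; last exact: abelemS sEC abelC.
have [sEP cQE] := subsetIP sEC.
rewrite dprodE //; last first.
  apply/trivgP; rewrite -tiE subsetI subsetIr subsetI subsetIl.
  by rewrite subIset // sEC orbT.
apply/eqP; rewrite eqEsubset mul_subG //=; apply/subsetP=> g Pg.
have /subsetP/(_ g Pg) := dedekind_Q8_cprod dP Px Py ox oy xy yx.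
case/mulsgP=> z q Cz Qq def_g.
have: z \in 'C_P(Q).
  by rewrite inE Cz andbT -(groupMr z (subsetP sQP q Qq)) -def_g.
rewrite -defC => /mulsgP[d e /setIP[Qd _] Ee def_z].
rewrite def_g def_z -mulgA (centP (subsetP cQE e Ee) q Qq) mulgA.
by rewrite mem_mulg ?groupM.
Qed.

End Dedekind.

(** * The characterisation *)

Unset Implicit Arguments.

Theorem theorem3 (gT : finGroupType) (G : {group gT}) :
  SNorm G = Nilp G <->
  (forall p : nat, prime p -> odd p ->
     forall P : {group gT}, p.-Sylow(G) P -> abelian P) /\
  (forall S : {group gT}, 2.-Sylow(G) S ->
     abelian S \/
     exists Q E : {group gT},
       [/\ Q \x E = S, Q \isog 'Q_8 & 2.-abelem E]).
Proof.
apply: (iff_trans (eq_graphs_dedekind G)).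
split=> [dedS | [abS Q8S] p P p_pr sylP].
  split=> [p p_pr odd_p P sylP | S sylS].
    apply: contraLR odd_p => ncP.
    have dP := dedS p P p_pr sylP.
    by have [->] := dedekind_pgroup_structure p_pr (pHall_pgroup sylP) dP ncP.
  have [| ncS] := boolP (abelian S); [by left | right].
  have dS : dedekind S by apply: (dedS 2).
  by case: (dedekind_pgroup_structure _ (pHall_pgroup sylS) dS ncS).
have [odd_p | even_p] := boolP (odd p).
  exact: abelian_dedekind (abS p p_pr odd_p P sylP).
have p2: p = 2 by case/even_prime: p_pr even_p => // ->.
rewrite p2 in sylP; case: (Q8S P sylP) => [/abelian_dedekind // | [Q [E []]]].
exact: dedekind_dprod_Q8.
Qed.
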